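(* Let $M$ be a smooth manifold with a Riemannian metric $\alpha=\sqrt{\alpha_{ij}(x)y^iy^j}$ and a $1$-form $\beta=b_i(x)y^i$, put $s=\beta/\alpha$ and $b=b(x)=\|\beta\|_\alpha$, and suppose that $b>1/\sqrt2$. Put $k=\sqrt{\frac{2b^2-1}{3}}$ and $$\mathcal D=\Big(-k,\tfrac{1-\sqrt5}{2}\Big)\cup\Big(\tfrac{1+\sqrt5}{2},k\Big).$$ Then the golden $(\alpha,\beta)$-metric $F=\alpha\,(s^2-s-1)$ is a Finsler metric on the open conic subset $\{(x,y)\in TM\setminus\{0\}: s(x,y)\in\mathcal D\}$ of the slit tangent bundle.
   Context: Here $\|\beta\|_\alpha$ is the norm of $\beta_x$ with respect to $\alpha_x$, so $b^2=\alpha^{ij}b_ib_j$ with $(\alpha^{ij})$ the inverse matrix of $(\alpha_{ij})$; $b$, $k$ and $\mathcal D$ depend on $x$. An interval $(p,q)$ with $p\ge q$ is understood to be empty. A (conic) Finsler metric on an open conic subset $\mathfrak U$ of the slit tangent bundle $TM\setminus\{0\}$ (conic: $u\in\mathfrak U$, $\lambda>0$ imply $\lambda u\in\mathfrak U$) is a smooth function $F:\mathfrak U\to(0,\infty)$, positively homogeneous of degree $1$ in $y$, such that the $2$-form $\Omega=\frac12 dd_JF^2$ has maximal rank on $\mathfrak U$; equivalently, the matrix $g_{ij}=\frac12\frac{\partial^2F^2}{\partial y^i\partial y^j}$ is non-degenerate at every point of $\mathfrak U$. (Here $J$ is the vertical endomorphism of $TM$ and $d_Jf=df\circ J$.) 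*)

(* Defs.v *)
From HB Require Import structures.
From mathcomp Require Import all_boot all_order all_algebra.
From mathcomp Require Import all_classical all_reals all_analysis.

Set Implicit Arguments.
Unset Strict Implicit.
Unset Printing Implicit Defensive.
Import Order.TTheory GRing.Theory Num.Theory.
Import numFieldNormedType.Exports.

Local Open Scope classical_set_scope.
Local Open Scope ring_scope.

(* Intended for an open set U of a finite-dimensional space V, where all
   directional derivatives being C^k amounts to all partial derivatives
   being C^k.  The values of f outside U are irrelevant. *)
Fixpoint Ck (R : realType) (V W : normedModType R) (k : nat) (U : set V)
    (f : V -> W) : Prop :=
  if k is k'.+1 then
    (forall x, U x -> differentiable f x) /\
    (forall v : V, Ck k' U (fun x => 'D_v f x))
  else forall x, U x -> {for x, continuous f}.

Definition smooth_on (R : realType) (V W : normedModType R) (U : set V)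
    (f : V -> W) : Prop := forall k, Ck k U f.

(* Any smooth atlas is allowed, in particular the maximal one.  The functions
   [coord c] and [icoord c] are total, but only meaningful on [dom c] and on
   its image [coord c @` dom c] respectively. *)
Record smooth_manifold (R : realType) (n : nat) := SmoothManifold {
  carrier :> topologicalType ;
  mfd_hausdorff : hausdorff_space carrier ;
  mfd_second_countable : @second_countable carrier ;
  chart : Type ;
  dom : chart -> set carrier ;
  coord : chart -> carrier -> 'rV[R]_n ;
  icoord : chart -> 'rV[R]_n -> carrier ;
  chart_at : carrier -> chart ;
  dom_chart_at : forall p, dom (chart_at p) p ;
  open_dom : forall c, open (dom c) ;
  open_coord_dom : forall c, open (coord c @` dom c) ;
  coordK : forall c p, dom c p -> icoord c (coord c p) = p ;
  continuous_coord : forall c p, dom c p -> {for p, continuous (coord c)} ;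
  continuous_icoord : forall c u, (coord c @` dom c) u ->
    {for u, continuous (icoord c)} ;
  smooth_transition : forall c d,
    smooth_on (coord c @` (dom c `&` dom d)) (coord d \o icoord c) }.

Section Tangent.
Context (R : realType) (n : nat) (M : smooth_manifold R n).

Definition codom (c : chart M) : set 'rV[R]_n := coord c @` dom c.

(* The tangent space at p is identified with R^n through the components of
   vectors in the chart [chart_at p]. *)
Definition tangent_space (p : M) := 'rV[R]_n.

Record tangent_vector := TangentVector {
  foot : M ; vec : tangent_space foot }.

Definition tscale (a : R) (v : tangent_vector) : tangent_vector :=
  @TangentVector (foot v) (a *: (vec v : 'rV[R]_n)).

(* The tangent vector at p whose components in the chart c are y. *)
Definition tangent_of (c : chart M) (p : M) (y : 'rV[R]_n) : tangent_space p :=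
  'd (coord (chart_at p) \o icoord c) (coord c p) y.

Definition coord_vector (c : chart M) (p : M) (i : 'I_n) : tangent_space p :=
  tangent_of c p (delta_mx 0 i).

(* The inverse of the chart of the tangent bundle induced by c: natural
   coordinates (x, y) to tangent vectors. *)
Definition itcoord (c : chart M) (z : 'rV[R]_n * 'rV[R]_n) : tangent_vector :=
  @TangentVector (icoord c z.1) (tangent_of c (icoord c z.1) z.2).

Definition tpullback (c : chart M) (U : set tangent_vector) :
    set ('rV[R]_n * 'rV[R]_n) :=
  [set z | codom c z.1 /\ U (itcoord c z)].

Definition topen (U : set tangent_vector) : Prop :=
  forall c, open (tpullback c U).

Definition tsmooth_on (U : set tangent_vector) (f : tangent_vector -> R) : Prop :=
  forall c, smooth_on (tpullback c U) (f \o itcoord c : _ -> R^o).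

Record riemannian_metric := RiemannianMetric {
  metric :> forall p : M, tangent_space p -> tangent_space p -> R ;
  metric_sym : forall (p : M) (v w : tangent_space p),
    metric v w = metric w v ;
  metric_linear : forall (p : M) (a : R) (v v' w : 'rV[R]_n),
    @metric p (a *: v + v') w = a * @metric p v w + @metric p v' w ;
  metric_posdef : forall (p : M) (v : 'rV[R]_n), v != 0 -> 0 < @metric p v v ;
  metric_smooth : forall (c : chart M) (i j : 'I_n),
    smooth_on (codom c)
      (fun u => metric (coord_vector c (icoord c u) i)
                       (coord_vector c (icoord c u) j) : R^o) }.

Record one_form := OneForm {
  form :> forall p : M, tangent_space p -> R ;
  form_linear : forall (p : M) (a : R) (v v' : 'rV[R]_n),
    @form p (a *: v + v') = a * @form p v + @form p v' ;
  form_smooth : forall (c : chart M) (i : 'I_n),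
    smooth_on (codom c) (fun u => form (coord_vector c (icoord c u) i) : R^o) }.

(* b^2 = alpha^{ij} b_i b_j does not depend on the chart around p in which it
   is computed. *)
Definition form_norm (alpha : riemannian_metric) (beta : one_form) (p : M) : R :=
  let e := coord_vector (chart_at p) p in
  let A := \matrix_(i, j) alpha p (e i) (e j) in
  let b := \row_i beta p (e i) in
  Num.sqrt ((b *m invmx A *m b^T) 0 0).

Definition metric_norm (alpha : riemannian_metric) (v : tangent_vector) : R :=
  Num.sqrt (alpha (foot v) (vec v) (vec v)).

(* The matrix g_ij of F at the tangent vector with natural coordinates (x, y)
   in the chart c. *)
Definition fundamental_matrix (F : tangent_vector -> R) (c : chart M)
    (x y : 'rV[R]_n) : 'M[R]_n :=
  \matrix_(i, j) (2^-1 *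
    'D_(delta_mx 0 i) (fun z =>
      'D_(delta_mx 0 j) (fun w => F (itcoord c (x, w)) ^+ 2 : R^o) z) y).

Record is_conic_finsler (U : set tangent_vector) (F : tangent_vector -> R) :
    Prop := IsConicFinsler {
  finsler_slit : forall v, U v -> vec v != (0 : 'rV[R]_n) ;
  finsler_open : topen U ;
  finsler_conic : forall v (a : R), U v -> 0 < a -> U (tscale a v) ;
  finsler_pos : forall v, U v -> 0 < F v ;
  finsler_smooth : tsmooth_on U F ;
  finsler_homogeneous : forall v (a : R), U v -> 0 < a ->
    F (tscale a v) = a * F v ;
  finsler_nondegenerate : forall (c : chart M) (x y : 'rV[R]_n),
    codom c x -> U (itcoord c (x, y)) ->
    \det (fundamental_matrix F c x y) != 0 }.

End Tangent.

(* Main.v *)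
(** Over a chart, with [A] the Gram matrix, [b] the components of the form,
    [q = y A y^T], [f = y b^T], [r = 1 / sqrt q], [m = y A] and [s = f r], one
    has [F = f^2 r - f - q r], a smooth function of (x, y) as long as y <> 0.
    On the cone, [F = (s^2 - s - 1) / r] is positive.

    If [u] is in the kernel of [g = dF dF + F Hess F], contracting with [y]
    gives [dF(u) = 0] by homogeneity, hence [Hess F (u, .) = 0].  Contracting
    this with the vector [B] dual to the form yields
      [r (f(u) - f r^2 m(u)) (2 (b^2 - s^2) - (s^2 + 1)) = 0],
    whose last factor is positive because [3 s^2 + 1 < 2 b^2].  Together with
    [dF(u) = 0] this forces [m(u) = f(u) = 0], and then [Hess F (u, u)] is a
    nonzero multiple of [u A u^T], so [u = 0].

    The norm [b] is only given in one preferred chart around each point; the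
    cone is open because [3 s^2 + 1 < 2 b^2] holds iff some tangent vector [w]
    satisfies [(3 s^2 + 1) alpha(w, w) < 2 beta(w)^2]. *)
Require Import Defs.
From HB Require Import structures.
From mathcomp Require Import all_boot all_order all_algebra.
From mathcomp Require Import all_classical all_reals all_analysis.
From mathcomp Require Import ring lra.

Set Implicit Arguments.
Unset Strict Implicit.
Unset Printing Implicit Defensive.
Import Order.TTheory GRing.Theory Num.Theory.
Import numFieldNormedType.Exports.
(* Repeated because MathComp rebinds [codom] and [coord]. *)
Import Defs.

Local Open Scope classical_set_scope.
Local Open Scope ring_scope.

(** * Calculus of C^k functions: sums, products, linear substitution, inverse square roots *)

Section SmoothCalculus.
Context {R : realType}.

(** The first-order expansion of [f] at [x] only involves values near [x], so it is also one of [g];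
    uniqueness of the differential then identifies ['d g x] with ['d f x]. *)
Lemma near_eq_differentiable (V W : normedModType R) (f g : V -> W) (x : V) :
  (\forall z \near x, f z = g z) -> differentiable f x -> differentiable g x.
Proof.
move=> fg /diff_locallyP[dc dE].
have H : g \o shift x = cst (g x) + 'd f x +o_ 0 id.
  apply/eqaddoP => _ /posnumP[e].
  have /eqaddoP/(_ e%:num)/(_ [gt0 of e%:num]) := dE.
  have n0 : \forall z \near (0 : V), f (z + x) = g (z + x).
    have := fg; rewrite (near_shift 0) subr0 => fg0.
    by apply: filterS fg0.
  apply: filterS2 n0 => z; rewrite !fctE /= => ->.
  by rewrite (nbhs_singleton fg).
apply/diff_locallyP; rewrite (diff_unique dc H); split=> //.
Qed.

(** On an open set, agreement at each point is agreement near each point, so all derivatives agree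
    as well. This allows a derivative to be replaced by its explicit formula, which is only known
    inside [U]. *)
Lemma Ck_ext (V W : normedModType R) k (U : set V) (f g : V -> W) :
  open U -> (forall x, U x -> f x = g x) -> Ck k U f -> Ck k U g.
Proof.
move=> oU; elim: k f g => [|k IHk] f g fg.
  move=> fC x Ux; have nfg : \forall z \near x, f z = g z.
    by apply: filterS (open_nbhs_nbhs (conj oU Ux)) => z; exact: fg.
  suff : g @ x --> g x by []; rewrite -(fg _ Ux).
  by apply: cvg_trans (fC x Ux); exact: near_eq_cvg.
have nfg x : U x -> \forall z \near x, f z = g z.
  by move=> Ux; apply: filterS (open_nbhs_nbhs (conj oU Ux)) => z; exact: fg.
case=> fd fD; split.
  by move=> x Ux; exact: near_eq_differentiable (nfg x Ux) (fd x Ux).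
move=> v; apply: IHk (fD v) => x Ux.
exact: near_eq_derive (nfg x Ux).
Qed.

Lemma CkS (V W : normedModType R) k (U : set V) (f : V -> W) :
  Ck k.+1 U f -> Ck k U f.
Proof.
elim: k f => [|k IHk] f [fd fD].
  by move=> x /fd/differentiable_continuous.
by split=> // v; exact: IHk.
Qed.

Lemma Ck_subset (V W : normedModType R) k (U U' : set V) (f : V -> W) :
  U' `<=` U -> Ck k U f -> Ck k U' f.
Proof.
move=> sU; elim: k f => [|k IHk] f; first by move=> fC x /sU; exact: fC.
by case=> fd fD; split=> [x Ux|v]; [exact/fd/sU|exact: IHk (fD v)].
Qed.

Lemma Ck_cst (V W : normedModType R) k (U : set V) (a : W) :
  Ck k U (fun _ : V => a).
Proof.
elim: k a => [|k IHk] a; first by move=> x _; exact: cvg_cst.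
split=> [x _|v]; first exact: differentiable_cst.
have -> : (fun x => 'D_v (fun _ : V => a) x) = (fun=> 0); last exact: IHk.
by apply/funext => x; rewrite derive_cst.
Qed.

Lemma CkD (V W : normedModType R) k (U : set V) (f g : V -> W) :
  open U -> Ck k U f -> Ck k U g -> Ck k U (fun x => f x + g x).
Proof.
move=> oU; elim: k f g => [|k IHk] f g.
  by move=> fC gC x Ux; apply: cvgD; [exact: fC|exact: gC].
move=> [fd fD] [gd gD]; split=> [x Ux|v].
  by apply: differentiableD; [exact: fd|exact: gd].
apply: Ck_ext (IHk _ _ (fD v) (gD v)) => // x Ux.
by rewrite -deriveD //; apply: diff_derivable; [exact: fd|exact: gd].
Qed.

Lemma CkM (V : normedModType R) k (U : set V) (f g : V -> R^o) :
  open U -> Ck k U f -> Ck k U g -> Ck k U (fun x => f x * g x : R^o).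
Proof.
move=> oU; elim: k f g => [|k IHk] f g.
  by move=> fC gC x Ux; apply: cvgM; [exact: fC|exact: gC].
move=> fS gS; have [[fd fD] [gd gD]] := (fS, gS); split=> [x Ux|v].
  by apply: differentiableM; [exact: fd|exact: gd].
(* The product rule keeps one factor undifferentiated in each term; [CkS] lowers its regularity to
   match the induction hypothesis. *)
apply: Ck_ext (CkD oU (IHk _ _ (CkS fS) (gD v))
  (IHk _ _ (CkS gS) (fD v))) => // x Ux.
transitivity ('D_v ((f : V -> R) * g) x); last by [].
by rewrite deriveM //; apply: diff_derivable; [exact: fd|exact: gd].
Qed.

Lemma Ck_sum (V : normedModType R) k (U : set V) (I : Type) (r : seq I)
    (f : I -> V -> R^o) :
  open U -> (forall i, Ck k U (f i)) ->
  Ck k U (fun x => \sum_(i <- r) f i x : R^o).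
Proof.
move=> oU fS; elim: r => [|i r IHr].
  by apply: Ck_ext (Ck_cst _ _ 0) => // x _; rewrite big_nil.
by apply: Ck_ext (CkD oU (fS i) IHr) => // x _; rewrite big_cons.
Qed.

Lemma Ck_linear (V W : normedModType R) k (U : set V) (L : {linear V -> W}) :
  continuous L -> Ck k U L.
Proof.
case: k => [|k] Lc; first by move=> x _; exact: Lc.
split=> [x _|v]; first exact: linear_differentiable.
have -> : (fun x => 'D_v L x) = (fun=> L v); last exact: Ck_cst.
by apply/funext => x; rewrite deriveE ?diff_lin//; exact: linear_differentiable.
Qed.

(** For linear [L] the chain rule reads D_v (f o L) = (D_{L v} f) o L, again a composite with [L],
    so the induction closes. It is applied to the two projections of a product. *)
Lemma Ck_comp_linear (V V' W : normedModType R) k (U : set V) (U' : set V')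
    (L : {linear V -> V'}) (f : V' -> W) :
  continuous L -> open U -> (forall x, U x -> U' (L x)) -> Ck k U' f ->
  Ck k U (fun x => f (L x)).
Proof.
move=> Lc oU UU'; elim: k f => [|k IHk] f.
  move=> fC x Ux; apply: continuous_comp; [exact: Lc|exact: fC (UU' _ Ux)].
case=> fd fD; split=> [x Ux|v].
  apply: (@differentiable_comp _ _ _ _ L f); last exact: fd (UU' _ Ux).
  exact: linear_differentiable.
apply: Ck_ext (IHk _ (fD (L v))) => // x Ux; have fdx := fd _ (UU' _ Ux).
have Ld : differentiable L x by exact: linear_differentiable.
rewrite [RHS]deriveE; last exact: (@differentiable_comp _ _ _ _ L f).
by rewrite (diff_comp Ld fdx) /= diff_lin// deriveE.
Qed.

(** The derivative is a polynomial in r = 1 / sqrt q and the derivative of q, which is what makes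
    the induction in [Ck_rsqrt] work. *)
Lemma differentiable_rsqrt (V : normedModType R) (q : V -> R^o) (x : V) :
  differentiable q x -> 0 < q x ->
  differentiable (fun z => (Num.sqrt (q z))^-1 : R^o) x /\
  forall v, 'D_v (fun z => (Num.sqrt (q z))^-1 : R^o) x =
    - 2^-1 * (Num.sqrt (q x))^-1 ^+ 3 * 'D_v q x.
Proof.
move=> qd q0.
have s0 : Num.sqrt (q x) != 0 by rewrite gt_eqF// sqrtr_gt0.
have hs := is_derive1_sqrt q0.
have sd : differentiable (Num.sqrt : R -> R) (q x).
  by apply/derivable1_diffP; have [] := hs.
have sqd : differentiable (fun z => Num.sqrt (q z) : R^o) x.
  exact: (@differentiable_comp _ _ _ _ q (Num.sqrt : R -> R^o)).
have Dsq v : 'D_v (fun z => Num.sqrt (q z) : R^o) x =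
    'D_v q x * (2 * Num.sqrt (q x))^-1.
  rewrite [LHS]deriveE// (@diff_comp _ _ _ _ q (Num.sqrt : R -> R^o))//=.
  rewrite [in RHS]deriveE//.
  (* The derivative of the square root is known in direction 1; writing the increment as a multiple
     of 1 brings it in by linearity. *)
  transitivity ('d (Num.sqrt : R -> R) (q x) ('d q x v *: (1 : R))).
    by rewrite [_ *: _]mulr1.
  rewrite linearZ; congr (_ * _).
  by rewrite -[LHS]deriveE//; have [] := hs.
split; first exact: (@differentiableV _ _ (fun z => Num.sqrt (q z) : R^o)).
move=> v.
rewrite [LHS](@deriveV _ _ (fun z => Num.sqrt (q z) : R^o))//; last first.
  exact: diff_derivable.
rewrite Dsq /GRing.scale /= -exprVn; set d := 'D_v q x; field.
by rewrite s0.
Qed.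

Lemma Ck_rsqrt (V : normedModType R) k (U : set V) (q : V -> R^o) :
  open U -> (forall x, U x -> 0 < q x) -> Ck k U q ->
  Ck k U (fun z => (Num.sqrt (q z))^-1 : R^o).
Proof.
move=> oU q0; elim: k => [|k IHk] qS.
  move=> x Ux; apply: cvgV; first by rewrite gt_eqF// sqrtr_gt0 q0.
  by apply: continuous_comp; [exact: qS|exact: sqrt_continuous].
have [qd qD] := qS; have rS := IHk (CkS qS); split=> [x Ux|v].
  by have [] := differentiable_rsqrt (qd _ Ux) (q0 _ Ux).
have r3 := CkM oU rS (CkM oU rS rS).
apply: Ck_ext (CkM oU (CkM oU (Ck_cst _ _ _) r3) (qD v)) => // x Ux.
have [_ ->] := differentiable_rsqrt (qd _ Ux) (q0 _ Ux).
by rewrite !exprS expr0 mulr1.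
Qed.

End SmoothCalculus.

(** * Tangent vectors, the metric and the form in the coordinates of a chart *)

Section Charts.
Context (R : realType) (n : nat) (M : smooth_manifold R n).
Implicit Types (c d : chart M) (p : M).

Lemma icoordK c x : codom c x -> coord c (icoord c x) = x.
Proof. by case=> p cp <-; rewrite coordK. Qed.

Lemma dom_icoord c x : codom c x -> dom c (icoord c x).
Proof. by case=> p cp <-; rewrite coordK. Qed.

Lemma differentiable_transition c d p : dom c p -> dom d p ->
  differentiable (coord d \o icoord c) (coord c p).
Proof.
move=> cp dp; have [h _] := @smooth_transition _ _ M c d 1%N.
by apply: h; exists p.
Qed.

(** The two transition maps are mutually inverse near [coord c p], so by the chain rule their
    differentials compose to the identity. *)
Lemma diff_transitionK c d p y : dom c p -> dom d p ->
  'd (coord c \o icoord d) (coord d p)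
    ('d (coord d \o icoord c) (coord c p) y) = y.
Proof.
move=> cp dp; set f := coord d \o icoord c; set g := coord c \o icoord d.
have fd : differentiable f (coord c p) by exact: differentiable_transition.
have fp : f (coord c p) = coord d p by rewrite /f /= coordK.
have gd : differentiable g (f (coord c p)).
  by rewrite fp; exact: differentiable_transition.
have nfg : \forall u \near coord c p, u = (g \o f) u.
  have n1 : \forall u \near coord c p, codom c u.
    by apply: open_nbhs_nbhs; split; [exact: open_coord_dom|exists p].
  (* By continuity of [icoord c], points near [coord c p] still land in the open domain of [d]. *)
  have n2 : \forall u \near coord c p, dom d (icoord c u).
    apply: (@continuous_icoord _ _ M c (coord c p)); first by exists p.
    by rewrite coordK //; apply: open_nbhs_nbhs; split => //; exact: open_dom.
  near=> u.
  have cu : codom c u by near: u.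
  have du : dom d (icoord c u) by near: u.
  by rewrite /g /f /= coordK // icoordK.
have := near_eq_derive y nfg; rewrite [LHS]derive_id.
rewrite [RHS]deriveE; last exact: (differentiable_comp fd gd).
move=> E1; have E2 := congr1 (@^~ y) (diff_comp fd gd).
rewrite -fp.
exact: esym (etrans E1 E2).
Unshelve. all: by end_near. Qed.

Lemma tangent_of_bij c p : dom c p ->
  exists T : 'rV[R]_n -> 'rV[R]_n,
    cancel (tangent_of c p : _ -> 'rV[R]_n) T /\
    cancel T (tangent_of c p : _ -> 'rV[R]_n).
Proof.
move=> cp; exists ('d (coord c \o icoord (chart_at p)) (coord (chart_at p) p)).
by split=> y; rewrite /tangent_of diff_transitionK //; exact: dom_chart_at.
Qed.

Lemma tangent_ofE c p (y : 'rV[R]_n) :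
  tangent_of c p y = \sum_i y 0 i *: (coord_vector c p i : 'rV[R]_n).
Proof.
rewrite {1}(row_sum_delta y) /tangent_of linear_sum; apply: eq_bigr => i _.
by rewrite linearZ.
Qed.

Lemma tangent_of0 c p : tangent_of c p 0 = 0 :> 'rV[R]_n.
Proof. exact: linear0. Qed.

Lemma tangent_of_eq0 c p y : dom c p ->
  (tangent_of c p y == 0 :> 'rV[R]_n) = (y == 0).
Proof.
move=> /tangent_of_bij[T [TK _]]; rewrite -[RHS](inj_eq (can_inj TK)).
by rewrite tangent_of0.
Qed.

Variables (alpha : riemannian_metric M) (beta : one_form M).

(** The components of the metric in an arbitrary chart, whereas [form_norm] is computed in
    [chart_at p]. *)
Definition gram c p : 'M[R]_n :=
  \matrix_(i, j) alpha p (coord_vector c p i) (coord_vector c p j).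

Definition form_row c p : 'rV[R]_n := \row_i beta p (coord_vector c p i).

Lemma one_form0 p : beta p (0 : 'rV[R]_n) = 0.
Proof.
have := form_linear beta p 1 0 0.
by rewrite scaler0 addr0 mul1r => /esym /(canRL (addrK _)); rewrite subrr.
Qed.

Lemma one_formZ p a (v : 'rV[R]_n) : beta p (a *: v) = a * beta p v.
Proof. by have := form_linear beta p a v 0; rewrite addr0 one_form0 addr0. Qed.

Lemma one_form_sum p (I : Type) (r : seq I) (a : I -> R) (v : I -> 'rV[R]_n) :
  beta p (\sum_(i <- r) a i *: v i) = \sum_(i <- r) a i * beta p (v i).
Proof.
elim: r => [|i r IHr]; first by rewrite !big_nil one_form0.
by rewrite !big_cons form_linear IHr.
Qed.

Lemma metric0l p (w : 'rV[R]_n) : alpha p (0 : 'rV[R]_n) w = 0.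
Proof.
have := metric_linear alpha p 1 0 0 w.
by rewrite scaler0 addr0 mul1r => /esym /(canRL (addrK _)); rewrite subrr.
Qed.

Lemma metricZl p a (v w : 'rV[R]_n) : alpha p (a *: v) w = a * alpha p v w.
Proof.
by have := metric_linear alpha p a v 0 w; rewrite addr0 metric0l addr0.
Qed.

Lemma metric_suml p (I : Type) (r : seq I) (a : I -> R) (v : I -> 'rV[R]_n)
    (w : 'rV[R]_n) :
  alpha p (\sum_(i <- r) a i *: v i) w = \sum_(i <- r) a i * alpha p (v i) w.
Proof.
elim: r => [|i r IHr]; first by rewrite !big_nil metric0l.
by rewrite !big_cons metric_linear IHr.
Qed.

Lemma form_tangent_of c p y :
  beta p (tangent_of c p y) = (y *m (form_row c p)^T) 0 0.
Proof.
rewrite tangent_ofE one_form_sum mxE; apply: eq_bigr => i _.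
by rewrite !mxE.
Qed.

Lemma metric_tangent_of c p y w :
  alpha p (tangent_of c p y) (tangent_of c p w) =
  (y *m gram c p *m w^T) 0 0.
Proof.
rewrite -mulmxA tangent_ofE metric_suml mxE; apply: eq_bigr => i _.
congr (_ * _).
rewrite metric_sym tangent_ofE metric_suml mxE; apply: eq_bigr => j _.
by rewrite !mxE mulrC metric_sym.
Qed.

Lemma trmx_gram c p : (gram c p)^T = gram c p.
Proof. by apply/matrixP => i j; rewrite !mxE metric_sym. Qed.

Lemma gram_posdef c p (y : 'rV[R]_n) :
  dom c p -> y != 0 -> 0 < (y *m gram c p *m y^T) 0 0.
Proof.
move=> cp y0; rewrite -metric_tangent_of metric_posdef //.
by rewrite tangent_of_eq0.
Qed.

(** A nonzero vector in the left kernel would have length zero. *)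
Lemma gram_unitmx c p : dom c p -> gram c p \in unitmx.
Proof.
move=> cp; rewrite unitmxE unitfE; apply/negP => /eqP/eqP/det0P[y y0 yG].
by have := gram_posdef cp y0; rewrite yG mul0mx mxE ltxx.
Qed.

Lemma metric_ge0 p (v : 'rV[R]_n) : 0 <= alpha p v v.
Proof.
have [->|v0] := eqVneq v 0; first by rewrite metric0l.
exact/ltW/metric_posdef.
Qed.

(** [B] is the metric dual of the form, with components b A^{-1} in the preferred chart. It
    describes b^2 without reference to a chart. *)
Lemma dual_vectorP p : exists B : 'rV[R]_n,
  (forall v : 'rV[R]_n, alpha p B v = beta p v) /\
  form_norm alpha beta p ^+ 2 = beta p B.
Proof.
set c := chart_at p; have cp : dom c p by exact: dom_chart_at.
set u := form_row c p *m invmx (gram c p).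
have uG : u *m gram c p = form_row c p by rewrite mulmxKV // gram_unitmx.
have [T [TK KT]] := tangent_of_bij cp.
have BE (v : 'rV[R]_n) : alpha p (tangent_of c p u) v = beta p v.
  rewrite -(KT v) metric_tangent_of form_tangent_of uG.
  by rewrite -[in LHS](trmxK (form_row c p)) -trmx_mul [LHS]mxE.
exists (tangent_of c p u); split=> //.
(* Squaring removes the root because the radicand is alpha(B, B), hence nonnegative. *)
rewrite sqr_sqrtr; first by rewrite form_tangent_of.
rewrite -[X in 0 <= X]/((u *m (form_row c p)^T) 0 0) -form_tangent_of -BE.
exact: metric_ge0.
Qed.

End Charts.

(** A coordinate function, named so that a linear structure can be attached to it. *)
Definition row_component (R : realType) n (i : 'I_n)
  (y : 'rV[R]_n) : R^o := y 0 i.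

Lemma row_component_is_linear (R : realType) n (i : 'I_n) :
  linear (@row_component R n i).
Proof. by move=> a y w; rewrite /row_component !mxE. Qed.

HB.instance Definition _ (R : realType) n (i : 'I_n) :=
  GRing.isLinear.Build R _ _ _ (@row_component R n i)
    (@row_component_is_linear R n i).

Lemma Ck_row_component (R : realType) n k (U : set 'rV[R]_n) i :
  Ck k U (fun y => y 0 i : R^o).
Proof.
suff h : continuous (@row_component R n i) by exact: (Ck_linear _ _ h).
move=> y; exact: coord_continuous.
Qed.

Lemma open_neq0 (R : realType) (V : normedModType R) :
  open [set y : V | y != 0].
Proof.
rewrite (_ : mkset _ = ~` [set 0]); last by apply/seteqP; split=> y /= /eqP.
apply: closed_openC.
exact/accessible_closed_set1/hausdorff_accessible/norm_hausdorff.
Qed.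

(** * The domain of s as polynomial inequalities, and smoothness of metric and form in natural
    coordinates *)

Section GoldenDomain.
Context (R : realType) (n : nat) (M : smooth_manifold R n).
Variables (alpha : riemannian_metric M) (beta : one_form M).
Implicit Types (c : chart M) (p : M).

(** The Cauchy-Schwarz inequality for [w] and the dual vector [B]. *)
Lemma form_sqr_le p (w : 'rV[R]_n) :
  beta p w ^+ 2 <= form_norm alpha beta p ^+ 2 * alpha p w w.
Proof.
have [->|w0] := eqVneq w 0; first by rewrite one_form0 metric0l mulr0 expr0n.
have [B [BE ->]] := dual_vectorP alpha beta p.
set q := alpha p w w; have q0 : 0 < q by exact: metric_posdef.
(* With q = alpha(w, w), this vector has squared length q (q beta(B) - beta(w)^2), and q is
   positive. *)
have := metric_ge0 alpha p (q *: B + - beta p w *: w).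
rewrite metric_linear metricZl BE.
rewrite [alpha p w _]metric_sym metric_linear metricZl BE -/q.
rewrite -[- beta p w *: w]addr0 !form_linear one_form0 => H.
have : 0 <= q * (q * beta p B - beta p w ^+ 2).
  by apply: le_trans H _; rewrite le_eqVlt; apply/orP; left; apply/eqP; ring.
by rewrite pmulr_rge0 // subr_ge0 mulrC.
Qed.

(** From left to right this is Cauchy-Schwarz. Conversely [B] is a witness: alpha(B, B) = beta(B) =
    b^2 is positive since 0 < a < 2 b^2, so the inequality may be multiplied by it. *)
Lemma lt_form_norm2P p (a : R) : 0 < a ->
  (exists w : 'rV[R]_n, a * alpha p w w < 2 * beta p w ^+ 2) <->
  a < 2 * form_norm alpha beta p ^+ 2.
Proof.
move=> a0; split=> [[w H]|H].
  have le := form_sqr_le p w; have ge := metric_ge0 alpha p w.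
  set b2 := form_norm _ _ _ ^+ 2 in le *.
  rewrite ltNge; apply/negP => h; move: H; rewrite ltNge => /negP; apply.
  by nra.
have [B [BE bE]] := dual_vectorP alpha beta p.
exists B; rewrite BE; move: H; rewrite bE; set t := beta p B => H.
by nra.
Qed.

(** The roots of t^2 - t - 1 are (1 - sqrt 5) / 2 and (1 + sqrt 5) / 2, and 3 t^2 + 1 < 2 b^2 says
    t^2 < k^2. *)
Lemma golden_domainE (t b2 : R) : 1 / 2 < b2 ->
  let k := Num.sqrt ((2 * b2 - 1) / 3) in
  (- k < t < (1 - Num.sqrt 5) / 2 \/ (1 + Num.sqrt 5) / 2 < t < k) <->
  0 < t ^+ 2 - t - 1 /\ 3 * t ^+ 2 + 1 < 2 * b2.
Proof.
move=> hb k.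
have k0 : 0 <= k by exact: sqrtr_ge0.
have k2 : k ^+ 2 = (2 * b2 - 1) / 3 by rewrite sqr_sqrtr //; lra.
set r := Num.sqrt 5; have r0 : 0 <= r by exact: sqrtr_ge0.
have r2 : r ^+ 2 = 5 by rewrite sqr_sqrtr.
have r1 : 2 < r by nra.
have E : t ^+ 2 - t - 1 = (t - (1 - r) / 2) * (t - (1 + r) / 2).
  by have -> : (t - (1 - r) / 2) * (t - (1 + r) / 2) =
    t ^+ 2 - t + 1 / 4 - r ^+ 2 / 4; [field | rewrite r2; field].
split=> [[/andP[h1 h2]|/andP[h1 h2]]|[]]; rewrite E.
- by split; [rewrite nmulr_rgt0; lra | nra].
- by split; [rewrite pmulr_rgt0; lra | nra].
move=> h1 h2.
have h3 : (k - t) * (k + t) > 0 by nra.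
(* The factors k - t and k + t have positive product and nonnegative sum 2 k, so both are
   positive. *)
have [h4 h4'] : - k < t /\ t < k.
  by split; rewrite ltNge; apply/negP => h; nra.
have [h5|h5] := ltP t ((1 - r) / 2); first by left; apply/andP; split; lra.
right; apply/andP; split=> //; rewrite ltNge; apply/negP => h.
by nra.
Qed.

Definition chart_quad c (z : 'rV[R]_n * 'rV[R]_n) : R^o :=
  alpha (icoord c z.1) (tangent_of c _ z.2) (tangent_of c _ z.2).

Definition chart_form c (z : 'rV[R]_n * 'rV[R]_n) : R^o :=
  beta (icoord c z.1) (tangent_of c _ z.2).

Definition chart_slit c : set ('rV[R]_n * 'rV[R]_n) :=
  [set z | codom c z.1 /\ z.2 != 0].

Lemma open_preimage_fst c : open [set z : 'rV[R]_n * 'rV[R]_n | codom c z.1].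
Proof.
have := @open_coord_dom _ _ M c.
by apply: (open_comp (f := fst)) => z _; exact: cvg_fst.
Qed.

Lemma open_chart_slit c : open (chart_slit c).
Proof.
apply: openI; first exact: open_preimage_fst.
have sc : continuous (@snd 'rV[R]_n 'rV[R]_n) by move=> z; exact: cvg_snd.
by have := @open_comp _ _ _ _ (fun z _ => sc z) (@open_neq0 R 'rV[R]_n).
Qed.

Lemma Ck_fiber_component k (U : set ('rV[R]_n * 'rV[R]_n)) i :
  open U -> Ck k U (fun z => z.2 0 i : R^o).
Proof.
move=> oU.
have sc : continuous (@snd 'rV[R]_n 'rV[R]_n) by move=> z; exact: cvg_snd.
exact: (Ck_comp_linear sc oU (fun _ _ => I) (Ck_row_component k setT i)).
Qed.

Lemma smooth_chart_quad c : smooth_on [set z | codom c z.1] (chart_quad c).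
Proof.
move=> k; have oU := @open_preimage_fst c.
have h : Ck k [set z : 'rV[R]_n * 'rV[R]_n | codom c z.1]
  (fun z => \sum_i \sum_j
    z.2 0 i * (gram alpha c (icoord c z.1) i j * z.2 0 j) : R^o).
  apply: Ck_sum => // i; apply: Ck_sum => // j.
  apply: CkM => //; first exact: Ck_fiber_component.
  apply: CkM => //; last exact: Ck_fiber_component.
  have := @metric_smooth _ _ _ alpha c i j k.
  move=> /(@Ck_comp_linear _ _ _ _ k
    [set z : 'rV[R]_n * 'rV[R]_n | codom c z.1] _ fst) H.
  apply: Ck_ext (H _ _ _) => //.
    by move=> x _ /=; rewrite mxE.
  by move=> x; exact: cvg_fst.
apply: Ck_ext h => // z _; rewrite /chart_quad metric_tangent_of -mulmxA mxE.
apply: eq_bigr => i _; rewrite mxE mulr_sumr; apply: eq_bigr => j _.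
by rewrite [z.2^T _ _]mxE.
Qed.

Lemma smooth_chart_form c : smooth_on [set z | codom c z.1] (chart_form c).
Proof.
move=> k; have oU := @open_preimage_fst c.
have h : Ck k [set z : 'rV[R]_n * 'rV[R]_n | codom c z.1]
  (fun z => \sum_i z.2 0 i * form_row beta c (icoord c z.1) 0 i : R^o).
  apply: Ck_sum => // i; apply: CkM => //; first exact: Ck_fiber_component.
  have := @form_smooth _ _ _ beta c i k.
  move=> /(@Ck_comp_linear _ _ _ _ k
    [set z : 'rV[R]_n * 'rV[R]_n | codom c z.1] _ fst) H.
  apply: Ck_ext (H _ _ _) => //.
    by move=> x _ /=; rewrite mxE.
  by move=> x; exact: cvg_fst.
apply: Ck_ext h => // z _; rewrite /chart_form form_tangent_of mxE.
by apply: eq_bigr => i _; rewrite [_^T _ _]mxE.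
Qed.

End GoldenDomain.

(** * The golden metric on its cone: openness, smoothness, positivity, homogeneity *)

Section GoldenMetric.
Context (R : realType) (n : nat) (M : smooth_manifold R n).
Variables (alpha : riemannian_metric M) (beta : one_form M).
Implicit Types (c : chart M) (p : M).

Definition form_ratio (v : tangent_vector M) : R :=
  beta (foot v) (vec v) / metric_norm alpha v.

Definition golden_metric (v : tangent_vector M) : R :=
  metric_norm alpha v * (form_ratio v ^+ 2 - form_ratio v - 1).

(** The condition that s lies in the given intervals, in the polynomial form of [golden_domainE]. *)
Definition golden_cone : set (tangent_vector M) :=
  [set v | [/\ vec v != (0 : 'rV[R]_n),
    0 < form_ratio v ^+ 2 - form_ratio v - 1 &
    3 * form_ratio v ^+ 2 + 1 < 2 * form_norm alpha beta (foot v) ^+ 2]].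

Lemma chart_quad_gt0 c z : chart_slit c z -> 0 < chart_quad alpha c z.
Proof.
case=> cz z0; apply: metric_posdef.
by rewrite tangent_of_eq0 //; exact: dom_icoord.
Qed.

Lemma smooth_chart_rsqrt c :
  smooth_on (chart_slit c)
    (fun z => (Num.sqrt (chart_quad alpha c z))^-1 : R^o).
Proof.
move=> k; apply: Ck_rsqrt; [exact: open_chart_slit|exact: chart_quad_gt0|].
by apply: Ck_subset (smooth_chart_quad alpha c k) => z [].
Qed.

Lemma smooth_form_ratio c :
  smooth_on (chart_slit c) (form_ratio \o itcoord c : _ -> R^o).
Proof.
move=> k; apply: CkM; [exact: open_chart_slit| |exact: smooth_chart_rsqrt].
by apply: Ck_subset (smooth_chart_form beta c k) => z [].
Qed.

Lemma smooth_golden_metric c :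
  smooth_on (chart_slit c) (golden_metric \o itcoord c : _ -> R^o).
Proof.
move=> k; have oS := @open_chart_slit R n M c.
have sS := @smooth_form_ratio c k.
have qS : Ck k (chart_slit c) (chart_quad alpha c).
  by apply: Ck_subset (smooth_chart_quad alpha c k) => z [].
(* The factor sqrt q is written as q times 1 / sqrt q, so that F is built from functions already
   known to be smooth. *)
have h := CkM oS (CkM oS qS (@smooth_chart_rsqrt c k))
  (CkD oS (CkD oS (CkM oS sS sS) (CkM oS (Ck_cst k _ (-1 : R^o)) sS))
     (Ck_cst k _ (-1 : R^o))).
apply: Ck_ext h => // z /chart_quad_gt0 q0.
rewrite /golden_metric /=.
have -> : metric_norm alpha (itcoord c z) = Num.sqrt (chart_quad alpha c z).
  by [].
set r := Num.sqrt _; set s := form_ratio _.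
have r0 : r != 0 by rewrite gt_eqF // sqrtr_gt0.
have -> : chart_quad alpha c z = r ^+ 2 by rewrite sqr_sqrtr // ltW.
by field.
Qed.

(** Here [w] is a row of components in the chart [c]. Since [tangent_of] is bijective, it ranges
    over all tangent vectors, and the norm in the preferred chart no longer occurs. *)
Lemma tpullback_golden_cone c z : tpullback c golden_cone z <->
  [/\ chart_slit c z,
    0 < form_ratio (itcoord c z) ^+ 2 - form_ratio (itcoord c z) - 1 &
    exists w : 'rV[R]_n,
      (3 * form_ratio (itcoord c z) ^+ 2 + 1) * chart_quad alpha c (z.1, w) <
      2 * chart_form beta c (z.1, w) ^+ 2].
Proof.
set s := form_ratio _; have s0 : 0 < 3 * s ^+ 2 + 1.
  by have := sqr_ge0 s; lra.
split=> [[cz [v0 h1 h2]]|[[cz z0] h1 [w h2]]].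
  have dz := dom_icoord cz; split=> //.
    by split=> //; rewrite -(tangent_of_eq0 _ dz).
  have /(lt_form_norm2P alpha beta (icoord c z.1) s0)[w h] := h2.
  have [T [_ KT]] := tangent_of_bij dz.
  by exists (T w); rewrite /chart_quad /chart_form /= KT.
have dz := dom_icoord cz; split=> //; split=> //.
  by rewrite /= tangent_of_eq0.
apply/(lt_form_norm2P alpha beta (icoord c z.1) s0).
by exists (tangent_of c (icoord c z.1) w).
Qed.

(** The row [w] that witnesses membership at [z] is kept fixed; the strict inequalities are
    continuous in the base point and the vector, so they persist near [z]. *)
Lemma topen_golden_cone : topen golden_cone.
Proof.
move=> c; rewrite openE => z /tpullback_golden_cone[Sz h1 [w h2]].
have sC : {for z, continuous (form_ratio \o itcoord c : _ -> R^o)}.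
  exact: (@smooth_form_ratio c 0%N).
have nS : \forall t \near z, chart_slit c t.
  by apply: open_nbhs_nbhs; split=> //; exact: open_chart_slit.
have wC : {for z, continuous (fun t : 'rV[R]_n * 'rV[R]_n => (t.1, w))}.
  suff : (fun t : 'rV[R]_n * 'rV[R]_n => (t.1, w)) @ z --> (z.1, w) by [].
  have c1 : (@fst 'rV[R]_n 'rV[R]_n) @ z --> z.1 by exact: cvg_fst.
  have c2 : (fun _ : 'rV[R]_n * 'rV[R]_n => w) @ z --> w by exact: cvg_cst.
  exact: cvg_pair c1 c2.
have czw : codom c (z.1, w).1 by case: Sz.
have qC : {for z, continuous (fun t => chart_quad alpha c (t.1, w))}.
  exact: continuous_comp wC (@smooth_chart_quad _ _ _ alpha c 0%N _ czw).
have fC : {for z, continuous (fun t => chart_form beta c (t.1, w))}.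
  exact: continuous_comp wC (@smooth_chart_form _ _ _ beta c 0%N _ czw).
pose s (t : 'rV[R]_n * 'rV[R]_n) := form_ratio (itcoord c t) : R^o.
pose q (t : 'rV[R]_n * 'rV[R]_n) := chart_quad alpha c (t.1, w) : R^o.
pose f (t : 'rV[R]_n * 'rV[R]_n) := chart_form beta c (t.1, w) : R^o.
have sz : s @ z --> s z by exact: sC.
have qz : q @ z --> q z by exact: qC.
have fz : f @ z --> f z by exact: fC.
have s2C : (fun t => s t ^+ 2 : R^o) @ z --> (s z ^+ 2 : R^o).
  exact: (cvgM sz sz).
have f2C : (fun t => f t ^+ 2 : R^o) @ z --> (f z ^+ 2 : R^o).
  exact: (cvgM fz fz).
have c1C (a : R^o) : (fun _ : 'rV[R]_n * 'rV[R]_n => a) @ z --> a.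
  exact: cvg_cst.
have n1 : \forall t \near z, 0 < s t ^+ 2 - s t - 1.
  have h : (fun t => s t ^+ 2 - s t - 1 : R^o) @ z -->
      (s z ^+ 2 - s z - 1 : R^o).
    exact: (cvgB (cvgB s2C sz) (c1C 1)).
  exact: (@cvgr_gt R _ _ _ _ _ h 0 h1).
have n2 : \forall t \near z, 0 < 2 * f t ^+ 2 - (3 * s t ^+ 2 + 1) * q t.
  move: h2; rewrite -subr_gt0 => h2.
  have h : (fun t => 2 * f t ^+ 2 - (3 * s t ^+ 2 + 1) * q t : R^o) @ z -->
      (2 * f z ^+ 2 - (3 * s z ^+ 2 + 1) * q z : R^o).
    exact: (cvgB (cvgM (c1C 2) f2C)
      (cvgM (cvgD (cvgM (c1C 3) s2C) (c1C 1)) qz)).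
  exact: (@cvgr_gt R _ _ _ _ _ h 0 h2).
apply: filterS3 nS n1 n2 => t St ht1 ht2.
apply/tpullback_golden_cone; split=> //.
by exists w; rewrite -subr_gt0.
Qed.

Lemma tsmooth_golden_metric : tsmooth_on golden_cone golden_metric.
Proof.
move=> c k; apply: Ck_subset (@smooth_golden_metric c k).
by move=> z /tpullback_golden_cone[].
Qed.

Lemma metric_norm_tscale a v : 0 < a ->
  metric_norm alpha (tscale a v) = a * metric_norm alpha v.
Proof.
move=> a0; rewrite /metric_norm /= metricZl metric_sym metricZl mulrA -expr2.
by rewrite sqrtrM ?sqr_ge0 // sqrtr_sqr gtr0_norm.
Qed.

Lemma form_ratio_tscale a v : 0 < a -> form_ratio (tscale a v) = form_ratio v.
Proof.
move=> a0; rewrite /form_ratio metric_norm_tscale //= one_formZ invfM mulrACA.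
by rewrite divff ?mul1r // gt_eqF.
Qed.

Lemma golden_cone_conic v a :
  golden_cone v -> 0 < a -> golden_cone (tscale a v).
Proof.
move=> [v0 h1 h2] a0; split; rewrite ?form_ratio_tscale //.
by rewrite /= scaler_eq0 negb_or gt_eqF.
Qed.

Lemma golden_metric_gt0 v : golden_cone v -> 0 < golden_metric v.
Proof.
move=> [v0 h1 h2]; rewrite /golden_metric mulr_gt0 // sqrtr_gt0.
exact: metric_posdef.
Qed.

Lemma golden_metric_tscale v a : 0 < a ->
  golden_metric (tscale a v) = a * golden_metric v.
Proof.
move=> a0; rewrite /golden_metric metric_norm_tscale // form_ratio_tscale //.
by rewrite mulrA.
Qed.

End GoldenMetric.

(** * The fundamental matrix on a single tangent space, as linear algebra in A and b *)

Section GoldenHessian.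
Context (R : realType) (n : nat).
Variables (A : 'M[R]_n) (b : 'rV[R]_n).
Hypothesis Asym : A^T = A.
Hypothesis Apos : forall u : 'rV[R]_n, u != 0 -> 0 < (u *m A *m u^T) 0 0.
Implicit Types u v w y z : 'rV[R]_n.

Let m u v : R := (u *m A *m v^T) 0 0.
Let f u : R := (u *m b^T) 0 0.
Let r u : R := (Num.sqrt (m u u))^-1.

Definition golden_norm u : R :=
  Num.sqrt ((u *m A *m u^T) 0 0) *
  (((u *m b^T) 0 0 / Num.sqrt ((u *m A *m u^T) 0 0)) ^+ 2 -
   (u *m b^T) 0 0 / Num.sqrt ((u *m A *m u^T) 0 0) - 1).

Let F u : R := f u * f u * r u - f u - m u u * r u.

Lemma golden_normE u : u != 0 -> golden_norm u = F u.
Proof.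
move=> u0; rewrite /F /r /f /golden_norm -/(m u u).
have q0 : 0 < m u u by exact: Apos.
have t0 : Num.sqrt (m u u) != 0 by rewrite gt_eqF // sqrtr_gt0.
set t := Num.sqrt (m u u) in t0 *.
have -> : m u u = t ^+ 2 by rewrite sqr_sqrtr // ltW.
by field.
Qed.

Let r_neq0 u : u != 0 -> r u != 0.
Proof. by move=> u0; rewrite invr_eq0 gt_eqF // sqrtr_gt0 Apos. Qed.

(** Used to eliminate m(u, u) in favour of r, after which [field] settles identities that rest on
    m(u, u) r(u)^2 = 1. *)
Let mr2 u : u != 0 -> m u u = (r u ^+ 2)^-1.
Proof. by move=> u0; rewrite /r exprVn invrK sqr_sqrtr // ltW // Apos. Qed.

Lemma mx11_mulE (X Y : 'M[R]_1) : (X *m Y) 0 0 = X 0 0 * Y 0 0.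
Proof. by rewrite mxE big_ord1. Qed.

Let mC u v : m u v = m v u.
Proof.
by rewrite /m -[in LHS](trmxK (u *m A *m v^T)) mxE !trmx_mul trmxK Asym mulmxA.
Qed.

(** For the polynomial functions below, the difference quotient simplifies to an [h] that is
    continuous at 0, and the derivative is [h 0]. *)
Lemma cvg_is_derive (g : 'rV[R]_n -> R) z v (dg : R) (h : R -> R) :
  (forall t, t != 0 -> t^-1 * (g (t *: v + z) - g z) = h t) ->
  h @ (0 : R) --> h 0 -> h 0 = dg -> is_derive z v g dg.
Proof.
move=> gh hC <-.
have H : (fun t => t^-1 *: ((g \o shift z) (t *: v) - g z)) @ (0 : R)^' --> h 0.
  have hC' : h @ (0 : R)^' --> h 0 by exact: cvg_within_filter hC.
  apply: cvg_trans hC'; apply: near_eq_cvg; near=> t.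
  rewrite /= -gh //; near: t; exact: nbhs_dnbhs_neq.
split; first by apply/cvg_ex; exists (h 0).
exact: cvg_lim.
Unshelve. all: by end_near. Qed.

Let fP a u v : f (a *: u + v) = a * f u + f v.
Proof. by rewrite /f mulmxDl -scalemxAl !mxE. Qed.

Let mPl a u v w : m (a *: u + v) w = a * m u w + m v w.
Proof. by rewrite /m !mulmxDl -!scalemxAl !mxE. Qed.

Let is_derive_f z v : is_derive z v f (f v).
Proof.
apply: (@cvg_is_derive _ _ _ _ (fun=> f v)) => // [t t0|]; last exact: cvg_cst.
by rewrite fP addrK mulKf.
Qed.

Let is_derive_m z u v : is_derive z u (fun z => m z v) (m u v).
Proof.
apply: (@cvg_is_derive _ _ _ _ (fun=> m u v)) => // [t t0|]; last first.
  exact: cvg_cst.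
by rewrite mPl addrK mulKf.
Qed.

Let is_derive_q z v : is_derive z v (fun z => m z z) (2 * m z v).
Proof.
apply: (@cvg_is_derive _ _ _ _ (fun t => t * m v v + 2 * m z v)).
- move=> t t0; rewrite mPl [m v _]mC [m z (_ + _)]mC !mPl [m v z]mC.
  by field.
- apply: cvgD; last exact: cvg_cst.
  by apply: cvgM; [exact: cvg_id|exact: cvg_cst].
- by rewrite mul0r add0r.
Qed.

(** [differentiable_rsqrt] asks for full differentiability, more than the directional derivatives of
    [is_derive_q]. *)
Let differentiable_q z : differentiable (fun z => m z z : R^o) z.
Proof.
have H : Ck 1 setT (fun z => \sum_i z 0 i * (\sum_j A i j * z 0 j) : R^o).
  apply: Ck_sum => [|i]; first exact: openT.
  apply: CkM; [exact: openT|exact: Ck_row_component|].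
  apply: Ck_sum => [|j]; first exact: openT.
  by apply: CkM; [exact: openT|exact: Ck_cst|exact: Ck_row_component].
have [|+ _] := @Ck_ext _ _ _ _ _ _ (fun z => m z z : R^o) openT _ H; last exact.
move=> y _; rewrite /m -mulmxA mxE; apply: eq_bigr => i _; rewrite mxE.
by congr (_ * _); apply: eq_bigr => j _; rewrite [y^T _ _]mxE.
Qed.

Let is_derive_r z v : z != 0 -> is_derive z v r (- r z ^+ 3 * m z v).
Proof.
move=> z0; have [rd rD] := differentiable_rsqrt (differentiable_q z) (Apos z0).
split; first exact: diff_derivable.
have -> : 'D_v r z = - 2^-1 * r z ^+ 3 * 'D_v (fun z => m z z) z by exact: rD.
have -> : 'D_v (fun z => m z z) z = 2 * m z v by have [] := is_derive_q z v.
by field.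
Qed.

(* Simplified by means of [m z z * r z ^+ 2 = 1]. *)
Let dF z v : R :=
  (2 * (f z * r z) - 1) * f v - (f z * f z * r z * r z * r z + r z) * m z v.

(** The Hessian of [F] at [z], obtained by differentiating [dF z v] in [z] along [u]. *)
Let hF z u v : R :=
  2 * r z * f u * f v - 2 * f z * r z ^+ 3 * (m z u * f v + f u * m z v)
  + (3 * f z ^+ 2 * r z ^+ 5 + r z ^+ 3) * m z u * m z v
  - (f z ^+ 2 * r z ^+ 3 + r z) * m u v.

Let is_derive_F z v : z != 0 -> is_derive z v F (dF z v).
Proof.
move=> z0; have hr := is_derive_r v z0.
have hf := is_derive_f z v; have hq := is_derive_q z v.
have H := is_deriveB (is_deriveB (is_deriveM (is_deriveM hf hf) hr) hf)
  (is_deriveM hq hr).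
refine (is_derive_eq (H : is_derive z v F _) _).
rewrite /dF /GRing.scale /= !fctE (mr2 z0).
by field; exact: r_neq0.
Qed.

Let is_derive_dF z u v : z != 0 ->
  is_derive z u (fun z => dF z v) (hF z u v).
Proof.
move=> z0; have hr := is_derive_r u z0.
have hf := is_derive_f z u; have hm := is_derive_m z u v.
have hc (a : R) : is_derive z u (cst a) 0 by exact: is_derive_cst.
have h1 := is_deriveB (is_deriveM (hc 2) (is_deriveM hf hr)) (hc 1).
have hf2r3 := is_deriveM (is_deriveM (is_deriveM (is_deriveM hf hf) hr) hr) hr.
have H := is_deriveB (is_deriveM h1 (hc (f v)))
  (is_deriveM (is_deriveD hf2r3 hr) hm).
refine (is_derive_eq (H : is_derive z u (fun z => dF z v) _) _).
rewrite /hF /GRing.scale /= !fctE /cst.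
by ring.
Qed.

Let golden_hessianE y u v : y != 0 ->
  2^-1 * 'D_u (fun z => 'D_v (fun w => golden_norm w ^+ 2 : R^o) z : R^o) y =
  dF y u * dF y v + F y * hF y u v.
Proof.
move=> y0.
have n0 z : z != 0 -> \forall w \near z, w != 0.
  by move=> z0; apply: open_nbhs_nbhs; split=> //; exact: open_neq0.
(* The outer derivative needs the inner one in a neighbourhood of y, and [golden_norm] agrees with
   [F] away from 0; both are available because nonzero vectors form an open set. *)
have inner : \forall z \near y,
    'D_v (fun w => golden_norm w ^+ 2 : R^o) z = F z * dF z v + F z * dF z v.
  apply: filterS (n0 _ y0) => z z0.
  have hF2 := is_deriveM (is_derive_F v z0) (is_derive_F v z0).
  rewrite -[RHS](derive_val (is_derive := hF2)); apply: near_eq_derive.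
  by apply: filterS (n0 _ z0) => w w0; rewrite golden_normE // expr2.
rewrite (near_eq_derive u inner).
have hFd := is_deriveM (is_derive_F u y0) (is_derive_dF u v y0).
have h2 := is_deriveD hFd hFd.
have -> : 'D_u (fun z => F z * dF z v + F z * dF z v : R^o) y = _ :=
  derive_val (is_derive := h2).
rewrite /GRing.scale /=; set p := F y; set p' := hF _ _ _; by field.
Qed.

(** Evaluates the rank-one pieces of the fundamental matrix as products of two linear forms. *)
Let rank1E (u w p q : 'rV[R]_n) :
  (u *m (p^T *m q) *m w^T) 0 0 = (u *m p^T) 0 0 * (w *m q^T) 0 0.
Proof.
rewrite mulmxA -mulmxA mx11_mulE; congr (_ * _).
by rewrite -[q *m w^T]trmxK [LHS]mxE trmx_mul trmxK.
Qed.

Lemma golden_hessian_det (B y : 'rV[R]_n) : B *m A = b -> y != 0 ->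
  let s := (y *m b^T) 0 0 / Num.sqrt ((y *m A *m y^T) 0 0) in
  0 < s ^+ 2 - s - 1 -> 3 * s ^+ 2 + 1 < 2 * (B *m b^T) 0 0 ->
  \det (\matrix_(i, j) (2^-1 * 'D_(delta_mx 0 i) (fun z =>
    'D_(delta_mx 0 j) (fun w => golden_norm w ^+ 2 : R^o) z : R^o) y)) != 0.
Proof.
move=> BA y0 s s1 s3; apply/negP => /det0P[u u0 uG].
(* The kernel equation u g = 0, paired with an arbitrary [w]. *)
have GE w : dF y u * dF y w + F y * hF y u w = 0.
  have : (u *m (\matrix_(i, j) (dF y (delta_mx 0 i) * dF y (delta_mx 0 j) +
      F y * hF y (delta_mx 0 i) (delta_mx 0 j))) *m w^T) 0 0 = 0.
    rewrite (_ : \matrix_(i, j) _ =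
      \matrix_(i, j) (2^-1 * 'D_(delta_mx 0 i) (fun z =>
        'D_(delta_mx 0 j) (fun w => golden_norm w ^+ 2 : R^o) z : R^o) y)).
      by rewrite uG mul0mx mxE.
    by apply/matrixP => i j; rewrite !mxE golden_hessianE.
  move=> <-; have [l lE] : exists l, l = y *m A by exists (y *m A).
  have fe i : f (delta_mx 0 i) = b 0 i by rewrite /f -rowE !mxE.
  have me i : m y (delta_mx 0 i) = l 0 i.
    rewrite mC /m -mulmxA -rowE lE -[in RHS](trmxK (y *m A)) trmx_mul Asym.
    by rewrite !mxE.
  have mee i j : m (delta_mx 0 i) (delta_mx 0 j) = A i j.
    by rewrite /m -rowE -{1}(trmxK (row i A)) -trmx_mul -rowE !mxE.
  have mE v : (v *m l^T) 0 0 = m y v.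
    by rewrite lE trmx_mul Asym mulmxA -/(m v y) mC.
  pose a1 := 2 * (f y * r y) - 1.
  pose a2 := f y * f y * r y * r y * r y + r y.
  (* The entries are values on basis vectors. Collecting them into rank-one matrices in b and l = y
     A, plus a multiple of A, makes the value on arbitrary [u] and [w] computable. *)
  rewrite (_ : \matrix_(i, j) _ =
    (a1 ^+ 2 + 2 * r y * F y) *: (b^T *m b)
    - (a1 * a2 + 2 * f y * r y ^+ 3 * F y) *: (b^T *m l + l^T *m b)
    + (a2 ^+ 2 + F y * (3 * f y ^+ 2 * r y ^+ 5 + r y ^+ 3)) *: (l^T *m l)
    - (F y * a2) *: A); last first.
    apply/matrixP => i j; rewrite !mxE !big_ord1 !mxE.
    by rewrite /hF /dF !fe !me !mee /a1 /a2; ring.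
  rewrite !(mulmxDr, mulmxDl, mulmxN, mulNmx) -!scalemxAr -!scalemxAl.
  have addE (X Y : 'M[R]_1) : (X + Y) 0 0 = X 0 0 + Y 0 0 by rewrite mxE.
  have oppE (X : 'M[R]_1) : (- X) 0 0 = - X 0 0 by rewrite mxE.
  have scaleE a (X : 'M[R]_1) : (a *: X) 0 0 = a * X 0 0 by rewrite mxE.
  rewrite !(mulmxDr, mulmxDl) !(addE, oppE, scaleE) !rank1E !mE.
  rewrite /hF /dF /a1 /a2 -/(f u) -/(f w) -/(m u w).
  by ring.
pose be := (B *m b^T) 0 0.
have mB w : m w B = f w.
  by rewrite mC /m BA /f -[in RHS](trmxK (w *m b^T)) [RHS]mxE trmx_mul trmxK.
have fB : f B = be by [].
have r0 : r y != 0 by exact: r_neq0.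
have s1' : (f y * r y) ^+ 2 - f y * r y - 1 != 0 by rewrite gt_eqF.
have F0 : F y != 0.
  have -> : F y = ((f y * r y) ^+ 2 - f y * r y - 1) / r y.
    by rewrite /F (mr2 y0); field.
  by rewrite mulf_neq0 // invr_eq0.
(* Euler's relations for a function homogeneous of degree 1: dF(y) = F, and y lies in the kernel of
   the Hessian. *)
have dFy : dF y y = F y by rewrite /dF /F (mr2 y0); field.
have hFy : hF y u y = 0 by rewrite /hF [m u y]mC (mr2 y0); field.
have dFu : dF y u = 0.
  have := GE y; rewrite dFy hFy mulr0 addr0 => /eqP.
  by rewrite mulf_eq0 (negPf F0) orbF => /eqP.
have hF0 w : hF y u w = 0.
  have := GE w; rewrite dFu mul0r add0r => /eqP.
  by rewrite mulf_eq0 (negPf F0) => /eqP.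
(* This comes from the Hessian paired with the dual vector [B], where m(w, B) = f(w). *)
have fu : f u = f y * r y ^+ 2 * m y u.
  have : r y * (f u - f y * r y ^+ 2 * m y u) *
      (2 * be - (3 * (f y * r y) ^+ 2 + 1)) = 0.
    by rewrite -(hF0 B) /hF !mB fB; ring.
  move/eqP; rewrite !mulf_eq0 (negPf r0) [X in _ || X]gt_eqF ?subr_gt0 // orbF.
  by rewrite subr_eq0 => /eqP.
(* With the value of f(u) inserted, dF(u) becomes r m(y, u) (s^2 - s - 1), whose last factor is
   nonzero on the cone. *)
have myu : m y u = 0.
  have : r y * m y u * ((f y * r y) ^+ 2 - f y * r y - 1) = 0.
    by rewrite -dFu /dF fu; ring.
  by move/eqP; rewrite !mulf_eq0 (negPf r0) (negPf s1') orbF => /eqP.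
(* Once f(u) and m(y, u) vanish, only the term - r (s^2 + 1) m(u, u) of the Hessian is left. *)
have muu : r y * ((f y * r y) ^+ 2 + 1) * m u u = 0.
  by rewrite -[RHS]oppr0 -(hF0 u) /hF fu myu; ring.
have := Apos u0; rewrite -/(m u u); move/eqP: muu.
rewrite !mulf_eq0 (negPf r0) [X in X || _]gt_eqF; last first.
  by rewrite ltr_wpDl ?sqr_ge0.
by move=> /eqP->; rewrite ltxx.
Qed.

End GoldenHessian.

(** * Transfer of nondegeneracy to an arbitrary chart *)

Section Nondegeneracy.
Context (R : realType) (n : nat) (M : smooth_manifold R n).
Variables (alpha : riemannian_metric M) (beta : one_form M).

Lemma golden_nondegenerate (c : chart M) (x y : 'rV[R]_n) : codom c x ->
  golden_cone alpha beta (itcoord c (x, y)) ->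
  \det (fundamental_matrix (golden_metric alpha beta) c x y) != 0.
Proof.
move=> cx [v0 s1 s2].
have dp := dom_icoord cx; move: v0 s1 s2; set p := icoord c x in dp *.
rewrite /= tangent_of_eq0 // => y0.
pose A := gram alpha c p; pose b := form_row beta c p.
have normE w : golden_metric alpha beta (itcoord c (x, w)) = golden_norm A b w.
  rewrite /golden_metric /form_ratio /metric_norm /= metric_tangent_of.
  by rewrite form_tangent_of.
rewrite /form_ratio /metric_norm /= metric_tangent_of form_tangent_of -/A -/b.
have [B [BE ->]] := dual_vectorP alpha beta p.
have [T [_ KT]] := tangent_of_bij dp.
(* Let t be the components of the dual vector in the chart [c]. Then t A = b, and b^2 = t b^T in
   this chart too. *)
have [t tB] : exists t, tangent_of c p t = B by exists (T B).
rewrite -{}tB in BE *; rewrite form_tangent_of -/b => s1 s2.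
have tA : t *m A = b.
  apply/rowP => i; rewrite [RHS]mxE -BE tangent_ofE metric_suml mxE.
  by apply: eq_bigr => j _; rewrite [A _ _]mxE.
have gE : (fun w => golden_metric alpha beta (itcoord c (x, w)) ^+ 2 : R^o) =
    (fun w => golden_norm A b w ^+ 2 : R^o).
  by apply/funext => w; rewrite normE.
rewrite /fundamental_matrix gE.
exact: (golden_hessian_det (trmx_gram alpha c p)
  (fun u => @gram_posdef _ _ _ alpha c p u dp) tA y0 s1 s2).
Qed.

End Nondegeneracy.

Theorem lemma2p2 (R : realType) (n : nat) (M : smooth_manifold R n)
    (alpha : riemannian_metric M) (beta : one_form M) :
  let b (x : M) : R := form_norm alpha beta x in
  let s (v : tangent_vector M) : R :=
    beta (foot v) (vec v) / metric_norm alpha v in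
  let k (x : M) : R := Num.sqrt ((2 * b x ^+ 2 - 1) / 3) in
  let D (x : M) : set R :=
    [set t | - k x < t < (1 - Num.sqrt 5) / 2] `|`
    [set t | (1 + Num.sqrt 5) / 2 < t < k x] in
  let F (v : tangent_vector M) : R :=
    metric_norm alpha v * (s v ^+ 2 - s v - 1) in
  (forall x : M, 1 / Num.sqrt 2 < b x) ->
  is_conic_finsler
    [set v | vec v != (0 : 'rV[R]_n) /\ D (foot v) (s v)] F.
Proof.
move=> b s k D F hb.
have b2 x : 1 / 2 < b x ^+ 2.
  have s2 : 0 < Num.sqrt 2 :> R by rewrite sqrtr_gt0.
  have -> : 1 / 2 = (1 / Num.sqrt 2) ^+ 2 :> R.
    by rewrite exprMn exprVn sqr_sqrtr // expr1n.
  have := hb x; set t := 1 / Num.sqrt 2; have t0 : 0 < t by rewrite divr_gt0.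
  by move=> tb; nra.
(* The bound b^2 > 1/2 makes [golden_domainE] applicable at every foot point. *)
have -> : [set v : tangent_vector M |
    vec v != (0 : 'rV[R]_n) /\ D (foot v) (s v)] =
    golden_cone alpha beta.
  apply/seteqP; split=> v /=.
    by move=> [v0 /(golden_domainE (s v) (b2 (foot v)))[h1 h2]].
  move=> [v0 h1 h2]; split=> //.
  exact/(golden_domainE (s v) (b2 (foot v))).
split.
- by move=> v [].
- exact: topen_golden_cone.
- exact: golden_cone_conic.
- exact: golden_metric_gt0.
- exact: tsmooth_golden_metric.
- by move=> v a _; exact: golden_metric_tscale.
- exact: golden_nondegenerate.
Qed.
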